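(* Let $k\ge1$ and $d\ge1$ be integers, $\Gamma=\widehat{\mathbb{Z}_2^{kd}}$, and let $H_K$ be the reproducing kernel Hilbert space of functions on $\Gamma$ with kernel $$K(a,b)=\sum_{l=(k_1,\dots,k_d)\in\mathbb{N}^d,\ |l|=k}\frac{1}{d^k}\binom{k}{l}\prod_{j=1}^d\prod_{i=1}^{k_j}\chi\big(a^j_i=b^j_i\big),\qquad a,b\in\Gamma.$$ Then the space $H_K$ has no nonconstant multiplier; that is, every multiplier of $H_K$ is a constant function.
   Context: $\mathbb{N}$ includes $0$; $|l|=k_1+\dots+k_d$; $\binom{k}{l}=\frac{k!}{k_1!\cdots k_d!}$; $\chi(P)=1$ if $P$ holds and $0$ otherwise; an empty product equals $1$. The dual group $\Gamma$ of $\mathbb{Z}_2^{kd}$ is identified with $\mathbb{Z}_2^{kd}$, whose elements are $k\times d$ binary matrices $a=(a_i^j)_{1\le i\le k,\,1\le j\le d}$. $H_K=\mathrm{span}\{K_b:\ b\in\Gamma\}$, where $K_b(a)=K(a,b)$, is the (finite-dimensional) Hilbert space of functions $\Gamma\to\mathbb{C}$ having $K$ as reproducing kernel. A multiplier of $H_K$ is a function $m:\Gamma\to\mathbb{C}$ such that the pointwise product $m\psi$ belongs to $H_K$ whenever $\psi\in H_K$.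
   Formalization: The formal theorem assumes d ≥ 2 instead of d ≥ 1: for d = 1 the kernel is K(a,b) = χ(a = b), so H_K consists of all functions on Γ and every function, including nonconstant ones, is a multiplier. *)

(* Defs.v *)
From HB Require Import structures.
From mathcomp Require Import all_boot all_order all_algebra reals complex.
Set Implicit Arguments. Unset Strict Implicit. Unset Printing Implicit Defensive.
Import GRing.Theory.
Local Open Scope ring_scope.
Local Open Scope complex_scope.

(* The dual group of Z_2^(k d), identified with Z_2^(k d): the entry a i j is
   a_(i+1)^(j+1), i.e. the upper index of a_i^j is the column. *)
Definition Gamma (k d : nat) := 'M['Z_2]_(k, d).

(* A multi-index l = (k_1, ..., k_d) in N^d with |l| = k has all its entries
   at most k, so it suffices to let l range over functions 'I_d -> {0, ..., k}.
   Row indices start at 0, so 1 <= i <= k_j reads i < l j. *)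
Definition kernel (R : realType) (k d : nat) (a b : Gamma k d) : R[i] :=
  \sum_(l : {ffun 'I_d -> 'I_k.+1} | (\sum_(j < d) l j == k)%N)
    (d%:R ^+ k)^-1 * (k`!%:R / \prod_(j < d) (l j)`!%:R)
    * \prod_(j < d) \prod_(i < k | (i < l j)%N) (a i j == b i j)%:R.

(* Functions Gamma -> C; C is written C^o to be seen as a C-vector space. *)
Definition cfun (R : realType) (k d : nat) := {ffun Gamma k d -> (R[i])^o}.

Definition HK (R : realType) (k d : nat) : {vspace cfun R k d} :=
  <<codom (fun b : Gamma k d => [ffun a => kernel R a b] : cfun R k d)>>%VS.

Definition is_multiplier (R : realType) (k d : nat) (H : {vspace cfun R k d})
    (m : Gamma k d -> R[i]) : Prop :=
  forall psi : cfun R k d,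
    psi \in H -> ([ffun a => m a * psi a] : cfun R k d) \in H.

(* Main.v *)
Require Import Defs.
From mathcomp Require Import all_boot all_order all_algebra reals complex.
From mathcomp Require Import ring zify.
Local Open Scope complex_scope.

(** The term of index [l] of the kernel depends on the first [l j] entries of
    each column [j] only, and these staircases have [k] cells in all.  Hence
    if [p] is any position and [q] is the last position of another column
    (there is one as [2 <= d]), no staircase contains both [p] and [q].  So
    each term of the kernel is insensitive to flipping one of the two entries,
    and the mixed second difference in the directions [p] and [q] annihilates
    the whole space ([mixed_diff_HK]).

    On the other hand the staircase filling the column of [q] contains [q], so
    the space contains functions that really depend on the entry at [q], and on
    it alone.  They are obtained by summing the kernel functions [K_b] over
    all [b] with a prescribed entry at [q]: by translation invariance the
    result takes a value [alpha] where the entry agrees and a value [beta]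
    where it does not ([slice_sumE]), and [0 <= beta < alpha]
    ([fiber_sum_lt]).

    Multiply these functions by a multiplier [m] and apply the mixed
    difference.  With [X] the difference of [m] in the direction [p] at [a] and
    [Y] the same difference after flipping [q], the two sums give
    [beta Y = alpha X] and [alpha Y = beta X], whence [X = 0].  As [p] and [a]
    are arbitrary, [m] is invariant under flipping any entry, so it is
    constant. *)

Set Implicit Arguments.
Unset Strict Implicit.
Unset Printing Implicit Defensive.
Import Order.TTheory GRing.Theory Num.Theory.
Local Open Scope ring_scope.

Lemma Z2_eq0_or_1 (x : 'Z_2) : x = 0 \/ x = 1.
Proof. by case: x => [[|[|n]] lt_n2] //; [left | right]; apply: val_inj. Qed.

Section Kernel.
Variables (R : realType) (k d : nat).
Implicit Types (a b c : Gamma k d) (l : {ffun 'I_d -> 'I_k.+1}).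
Implicit Types (i q : 'I_k) (j : 'I_d).

Definition agree l a b : bool :=
  [forall j, [forall (i : 'I_k | (i < l j)%N), a i j == b i j]].

Definition weight l : R[i] :=
  (d%:R ^+ k)^-1 * (k`!%:R / \prod_(j < d) (l j)`!%:R).

Definition flip i j a : Gamma k d := a + delta_mx i j.

Lemma agreeP l a b :
  reflect (forall j i, (i < l j)%N -> a i j = b i j) (agree l a b).
Proof.
apply: (iffP forallP) => [agr j i lt_i | agr j].
  by move/forall_inP: (agr j) => /(_ i lt_i)/eqP.
by apply/forall_inP => i lt_i; apply/eqP/agr.
Qed.

Lemma kernelE a b :
  kernel R a b = \sum_(l : {ffun 'I_d -> 'I_k.+1} | (\sum_(j < d) l j == k)%N)
                   weight l * (agree l a b)%:R.
Proof.
apply: eq_bigr => l _; congr (_ * _).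
case: agreeP => [agr | nagr].
  by rewrite big1 // => j _; rewrite big1 // => i lt_i; rewrite agr // eqxx.
apply/eqP/prodf_eq0; case: (pickP (fun j =>
    ~~ [forall (i : 'I_k | (i < l j)%N), a i j == b i j])) => [j | allj].
  rewrite negb_forall_in => /exists_inP[i lt_i neq_ij].
  exists j => //; apply/prodf_eq0; exists i => //.
  by rewrite (negPf neq_ij).
case: nagr => j i lt_i; apply/eqP.
by have /negbFE/forall_inP := allj j; apply.
Qed.

Lemma weight_gt0 l : (0 < d)%N -> 0 < weight l.
Proof.
move=> d_gt0; rewrite /weight mulr_gt0 ?invr_gt0 ?exprn_gt0 ?ltr0n //.
rewrite divr_gt0 ?ltr0n ?fact_gt0 //.
by apply: prodr_gt0 => j _; rewrite ltr0n fact_gt0.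
Qed.

Lemma kernel_ge0 a b : (0 < d)%N -> 0 <= kernel R a b.
Proof.
move=> d_gt0; rewrite kernelE sumr_ge0 // => l _.
by rewrite mulr_ge0 ?ler0n // ltW // weight_gt0.
Qed.

Lemma kernel_translate c a b : kernel R (a + c) (b + c) = kernel R a b.
Proof.
rewrite !kernelE; apply: eq_bigr => l _; congr (_ * _%:R).
congr nat_of_bool; apply: eq_forallb => j; apply: eq_forallb => i.
by rewrite !mxE (inj_eq (addIr _)).
Qed.

Lemma agree_flip l i j a b :
  (l j <= i)%N -> agree l (flip i j a) b = agree l a b.
Proof.
move=> le_li; apply: eq_forallb => j'; apply: eq_forallb => i'.
rewrite !mxE; case: (ltnP i' (l j')) => //= lt_i'.
suff /negPf-> : ~~ ((i' == i) && (j' == j)) by rewrite addr0.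
by apply: contraTN lt_i' => /andP[/eqP-> /eqP->]; rewrite -leqNgt.
Qed.

Lemma flip_comm i j q j' a : flip i j (flip q j' a) = flip q j' (flip i j a).
Proof. by rewrite /flip addrAC. Qed.

Lemma flipE i j q j' a :
  flip i j a q j' = a q j' + ((q == i) && (j' == j))%:R.
Proof. by rewrite !mxE. Qed.

(** Containing the last cell of column [j'] uses up all [k] cells of a
    staircase, which leaves none for any other column. *)
Lemma staircase_dichotomy l i q j j' :
  (\sum_(j0 < d) l j0)%N = k -> q = k.-1 :> nat -> j' != j ->
  (l j <= i)%N || (l j' <= q)%N.
Proof.
move=> + qE neq_j; rewrite (bigD1 j') // (bigD1 j) 1?eq_sym //= => suml.
by have := ltn_ord q; lia.
Qed.

Definition mixed_diff i j q j' (f : Gamma k d -> R[i]) a : R[i] :=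
  f (flip i j (flip q j' a)) - f (flip i j a) - (f (flip q j' a) - f a).

Lemma mixed_diff_kernel i j q j' a b :
  q = k.-1 :> nat -> j' != j -> mixed_diff i j q j' (fun x => kernel R x b) a = 0.
Proof.
move=> qE neq_j; rewrite /mixed_diff !kernelE -!sumrB big1 // => l /eqP suml.
case/orP: (staircase_dichotomy i suml qE neq_j) => le_l.
  by rewrite !(agree_flip _ _ le_l); ring.
by rewrite !(flip_comm i) !(agree_flip _ _ le_l); ring.
Qed.

Lemma kernel_mem_HK b :
  ([ffun a => kernel R a b] : cfun R k d) \in HK R k d.
Proof. exact/memv_span/codom_f. Qed.

Lemma mixed_diff_HK i j q j' (f : cfun R k d) a :
  q = k.-1 :> nat -> j' != j -> f \in HK R k d -> mixed_diff i j q j' f a = 0.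
Proof.
move=> qE neq_j.
set X := in_tuple
  (codom (fun b : Gamma k d => [ffun a => kernel R a b] : cfun R k d)).
move=> f_in; have {f_in} -> := coord_span (X := X) f_in.
rewrite /mixed_diff !sum_ffunE -!sumrB big1 // => n _.
have /codomP[b ->] : X`_n \in X by rewrite mem_nth // size_tuple.
have := mixed_diff_kernel i a b qE neq_j; rewrite /mixed_diff !ffunE => eq0.
by rewrite -!scalerBr [X in _ *: X]eq0 scaler0.
Qed.

Definition slice_sum q j (x : 'Z_2) : cfun R k d :=
  \sum_(b : Gamma k d | b q j == x) [ffun a => kernel R a b].

Definition fiber_sum q j (x : 'Z_2) : R[i] :=
  \sum_(b : Gamma k d | b q j == x) kernel R 0 b.

Lemma slice_sum_in_HK q j x : slice_sum q j x \in HK R k d.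
Proof. by apply: rpred_sum => b _; apply: kernel_mem_HK. Qed.

(** Translating the summation variable by [a] only moves the constraint on the
    entry at [(q, j)], so no other entry of [a] matters. *)
Lemma slice_sumE q j x a : slice_sum q j x a = fiber_sum q j (x - a q j).
Proof.
rewrite sum_ffunE (reindex_inj (addIr a)) /fiber_sum.
apply: eq_big => [b | b _]; first by rewrite !mxE [RHS]eq_sym subr_eq eq_sym.
by rewrite ffunE -{1}[a]add0r kernel_translate.
Qed.

Lemma fiber_sum_ge0 q j x : (0 < d)%N -> 0 <= fiber_sum q j x.
Proof. by move=> d_gt0; apply: sumr_ge0 => b _; apply: kernel_ge0. Qed.

(** Flipping an agreeing entry can only destroy agreements. *)
Lemma kernel_flip_le q j b :
  (0 < d)%N -> b q j = 0 -> kernel R 0 (flip q j b) <= kernel R 0 b.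
Proof.
move=> d_gt0 bq0; rewrite !kernelE; apply: ler_sum => l _.
apply: ler_wpM2l; first exact/ltW/weight_gt0.
rewrite ler_nat; case: agreeP => //= agr; case: agreeP => //=; case=> j' i' lt_i.
have := agr j' i' lt_i; rewrite flipE.
case: andP => [[/eqP-> /eqP->] _|_]; last by rewrite addr0.
by rewrite bq0 mxE.
Qed.

(** The staircase that fills column [j] sees the flip. *)
Lemma kernel_flip0_lt q j :
  kernel R 0 (flip q j 0) < kernel R 0 (0 : Gamma k d).
Proof.
have d_gt0 : (0 < d)%N by apply: leq_ltn_trans (ltn_ord j).
pose l0 : {ffun 'I_d -> 'I_k.+1} :=
  [ffun j' => if j' == j then ord_max else ord0].
have suml0 : (\sum_(j' < d) l0 j' == k)%N.
  rewrite (bigD1 j) //= ffunE eqxx big1 ?addn0 // => j' /negPf neq_j.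
  by rewrite ffunE neq_j.
rewrite !kernelE (bigD1 l0) //= [ltRHS](bigD1 l0) //=.
have agree00 l : agree l 0 0 by apply/agreeP.
apply: ltr_leD.
  rewrite agree00 ltr_pM2l ?weight_gt0 // ltr_nat ltnS leqn0 eqb0.
  apply/agreeP => /(_ j q); rewrite ffunE eqxx flipE !eqxx !mxE add0r.
  by move/(_ (ltn_ord q)).
apply: ler_sum => l _; apply: ler_wpM2l; first exact/ltW/weight_gt0.
by rewrite agree00 ler_nat leq_b1.
Qed.

(** Flipping matches the fibers over [0] and [1]; the inequality is weak
    termwise, and strict at the zero matrix. *)
Lemma fiber_sum_lt q j : fiber_sum q j 1 < fiber_sum q j 0.
Proof.
have d_gt0 : (0 < d)%N by apply: leq_ltn_trans (ltn_ord j).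
rewrite /fiber_sum (reindex_inj (addIr (delta_mx q j))) /=.
under eq_bigl => b.
  rewrite !mxE !eqxx -[X in _ == X]add0r (inj_eq (addIr _)).
  over.
rewrite (bigD1 0) ?mxE //= [ltRHS](bigD1 0) ?mxE //=.
apply: ltr_leD; first exact: kernel_flip0_lt.
by apply: ler_sum => b /andP[/eqP bq0 _]; apply: kernel_flip_le.
Qed.

(** The slice sums for the two possible entries at [q], taken in a column other
    than [j], give two linear equations for the differences [X] and [Y] of [m];
    their determinant [alpha ^+ 2 - beta ^+ 2] is nonzero. *)
Lemma multiplier_flip (m : Gamma k d -> R[i]) i j a :
  (2 <= d)%N -> is_multiplier (HK R k d) m -> m (flip i j a) = m a.
Proof.
move=> d_ge2 mult_m.
have k_gt0 : (0 < k)%N by apply: leq_ltn_trans (ltn_ord i).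
have [j' neq_j] : exists j', j' != j.
  apply/existsP; rewrite -[[exists _, _]]negbK negb_exists.
  apply/negP => /forallP eq_j; have := cardC1 j; rewrite card_ord eq_card0.
    by case: (d) d_ge2 => [|[]].
  by move=> j'; have := eq_j j'; rewrite !inE negbK => /eqP ->; rewrite eqxx.
have lt_q : (k.-1 < k)%N by rewrite ltn_predL.
pose q := Ordinal lt_q.
pose X := m (flip i j a) - m a.
pose Y := m (flip i j (flip q j' a)) - m (flip q j' a).
have relation x : fiber_sum q j' (x - a q j' - 1) * Y
                = fiber_sum q j' (x - a q j') * X.
  have := mixed_diff_HK i a (erefl : q = k.-1 :> nat) neq_j
            (mult_m _ (slice_sum_in_HK q j' x)).
  (* The slice functions do not see the flip at [(i, j)], so they factor out. *)
  rewrite /mixed_diff !ffunE !slice_sumE !flipE !eqxx (negPf neq_j) andbF.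
  rewrite !addr0 opprD addrA => eq0.
  apply/eqP; rewrite -subr_eq0 -[X in _ == X]eq0.
  by apply/eqP; rewrite /X /Y; ring.
have := relation (a q j'); rewrite subrr sub0r.
have -> : - 1 = 1 :> 'Z_2 by apply: val_inj.
have := relation (a q j' + 1); rewrite [X in X - a q j']addrC addrK subrr.
set alpha := fiber_sum q j' 0; set beta := fiber_sum q j' 1 => relA relB.
have beta_ge0 : 0 <= beta by apply: fiber_sum_ge0; apply: ltnW.
have lt_beta : beta < alpha by apply: fiber_sum_lt.
have : (alpha ^+ 2 - beta ^+ 2) * X = 0.
  rewrite mulrBl !expr2 -!mulrA -relB -relA; ring.
move/eqP; rewrite mulf_eq0 subr_eq0 orbC => /orP[|/eqP sqE].
  by rewrite subr_eq0 => /eqP.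
have : beta ^+ 2 < alpha ^+ 2.
  by rewrite ltr_pXn2r // nnegrE ltW // (le_lt_trans beta_ge0).
by rewrite sqE ltxx.
Qed.

Lemma flip_invariant_const (m : Gamma k d -> R[i]) :
  (forall i j a, m (flip i j a) = m a) -> forall a, m a = m 0.
Proof.
move=> m_flip a; rewrite -[a]add0r [a in 0 + a]matrix_sum_delta.
(* The periods of [m] are closed under addition. *)
suff per : forall b, m (b + \sum_i \sum_j a i j *: delta_mx i j) = m b by [].
elim/big_ind: _ => [b | x y per_x per_y b | i _]; rewrite ?addr0 ?addrA ?per_y //.
elim/big_ind: _ => [b | x y per_x per_y b | j _ b]; rewrite ?addr0 ?addrA ?per_y //.
case: (Z2_eq0_or_1 (a i j)) => ->; first by rewrite scale0r addr0.
by rewrite scale1r; apply: m_flip.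
Qed.

End Kernel.

Theorem proposition7 (R : realType) (k d : nat) (hk : (1 <= k)%N) (hd : (2 <= d)%N)
    (m : Gamma k d -> R[i]) :
  is_multiplier (HK R k d) m -> exists c : R[i], forall a : Gamma k d, m a = c.
Proof.
move=> mult_m; exists (m 0); apply: flip_invariant_const => i j a.
exact: multiplier_flip.
Qed.
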